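(* Let $(X,r)$ be a solution with $|X|=n$ finite, whose permutation group $\mathcal{G}(X,r)$ is cyclic. Then the Dehornoy's class of $(X,r)$ is bounded above by $g(n)$, where $g(n)$ is the maximum order of a permutation in $\mathrm{Sym}(n)$.
   Context: A solution is a pair $(X,r)$ with $X$ a non-empty set and $r:X\times X\to X\times X$, $r(x,y)=(\sigma_x(y),\tau_y(x))$, such that $(r\times \mathrm{id})(\mathrm{id}\times r)(r\times \mathrm{id})=(\mathrm{id}\times r)(r\times \mathrm{id})(\mathrm{id}\times r)$ on $X^3$, $r^2=\mathrm{id}$ (involutive), and all maps $\sigma_x,\tau_y:X\to X$ are bijections (non-degenerate). The permutation group $\mathcal{G}(X,r)$ is the subgroup of $\mathrm{Sym}(X)$ generated by all $\sigma_x$. Dehornoy's class: set $x\cdot y=\sigma_x^{-1}(y)$ and define $\Omega_m:X^m\to X$ by $\Omega_1(x_1)=x_1$ and $\Omega_m(x_1,\dots,x_m)=\Omega_{m-1}(x_1,\dots,x_{m-1})\cdot\Omega_{m-1}(x_1,\dots,x_{m-2},x_m)$ for $m>1$. The Dehornoy's class of $(X,r)$ is the minimal positive integer $d$ such that $\Omega_{d+1}(x,x,\dots,x,y)=y$ for all $x,y\in X$. *)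

(* Defs.v *)
From mathcomp Require Import all_boot all_fingroup all_solvable.

Set Implicit Arguments.
Unset Strict Implicit.
Unset Printing Implicit Defensive.

Section YangBaxterMaps.

Variables (X : Type) (r : X * X -> X * X).

Definition r_id (t : X * X * X) : X * X * X := (r t.1, t.2).

Definition id_r (t : X * X * X) : X * X * X :=
  let bc := r (t.1.2, t.2) in (t.1.1, bc.1, bc.2).

Definition braided := r_id \o id_r \o r_id =1 id_r \o r_id \o id_r.

Definition lmap (x y : X) : X := (r (x, y)).1.

Definition rmap (y x : X) : X := (r (x, y)).2.

Definition nondegenerate :=
  (forall x, bijective (lmap x)) /\ (forall y, bijective (rmap y)).

End YangBaxterMaps.

Structure solution (X : finType) := Solution {
  sol_map :> X * X -> X * X;
  sol_nonempty : 0 < #|X|;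
  sol_braided : braided sol_map;
  sol_involutive : involutive sol_map;
  sol_nondegenerate : nondegenerate sol_map
}.

Section Dehornoy.

Variables (X : finType) (r : solution X).

Definition sigma (x : X) : {perm X} :=
  perm (bij_inj ((sol_nondegenerate r).1 x)).

Definition permutation_group : {group {perm X}} :=
  <<[set sigma x | x : X]>>%G.

Definition dot (x y : X) : X := (sigma x)^-1%g y.

(* [Omega m] is the paper's Omega_{m+1}, with arguments x_1, ..., x_{m+1}
   indexed from 0: [lift ord_max] omits the last argument and
   [lift (inord m)] omits the last but one. *)
Fixpoint Omega (m : nat) : ('I_m.+1 -> X) -> X :=
  match m with
  | 0 => fun x => x ord0
  | m'.+1 => fun x =>
      dot (Omega (fun i : 'I_m'.+1 => x (lift ord_max i)))
          (Omega (fun i : 'I_m'.+1 => x (lift (inord m') i)))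
  end.

Definition const_then (d : nat) (x y : X) : 'I_d.+1 -> X :=
  fun i => if i == ord_max then y else x.

Definition dehornoy_prop (d : nat) : bool :=
  (0 < d) && [forall x, forall y, Omega (@const_then d x y) == y].

Lemma eq_Omega m (f g : 'I_m.+1 -> X) : f =1 g -> Omega f = Omega g.
Proof.
elim: m f g => [|m IHm] f g eqfg /=; first exact: eqfg.
by congr dot; apply: IHm => i; apply: eqfg.
Qed.

Lemma sigmaE x y : sigma x y = (r (x, y)).1.
Proof. by rewrite permE. Qed.

Definition diag (x : X) : X := dot x x.

Lemma diag_rmap x : rmap r (diag x) x = diag x.
Proof.
have sx : (r (x, diag x)).1 = x by rewrite -sigmaE /diag /dot permKV.
have := sol_involutive r (x, diag x); rewrite (surjective_pairing (r (x, _))).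
rewrite sx -/(rmap r (diag x) x) => rr.
apply: (@perm_inj _ (sigma x)); rewrite sigmaE rr /=.
by rewrite /diag /dot permKV.
Qed.

Lemma diag_inj : injective diag.
Proof.
move=> x y eqxy; apply: (bij_inj ((sol_nondegenerate r).2 (diag x))).
by rewrite diag_rmap eqxy diag_rmap.
Qed.

Lemma Omega_const m x : Omega (fun _ : 'I_m.+1 => x) = iter m diag x.
Proof. by elim: m => [|m IHm] //=; rewrite IHm. Qed.

Lemma Omega_const_then m x y :
  Omega (@const_then m.+1 x y) =
  dot (iter m diag x) (Omega (@const_then m x y)).
Proof.
rewrite /=; congr dot.
  rewrite -Omega_const; apply: eq_Omega => i.
  by rewrite /const_then eq_sym (negPf (neq_lift _ _)).
apply: eq_Omega => i; rewrite /const_then; congr (if _ then _ else _).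
rewrite -!val_eqE /= /bump inordK //; have := ltn_ord i.
rewrite ltnS; case: ltngtP => // [lt_im|->] _; last by rewrite add1n eqxx.
by rewrite add0n ltn_eqF // ltnW.
Qed.

Lemma dehornoy_exists : exists d, dehornoy_prop d.
Proof.
pose T := perm diag_inj; pose p := #[T]%g.
have TE k x : (T ^+ k)%g x = iter k diag x.
  by rewrite permX; apply: eq_iter => z; rewrite permE.
pose P k x := (\prod_(0 <= i < k) (sigma (iter i diag x))^-1)%g.
have PE k x y : Omega (@const_then k x y) = P k x y.
  rewrite /P; elim: k => [|k IHk]; first by rewrite big_geq // perm1.
  by rewrite Omega_const_then big_nat_recr //= permM -IHk.
have perT k x : iter (k * p) diag x = x.
  by rewrite -TE mulnC expgM expg_order expg1n perm1.
have PM k x : P (k * p) x = (P p x ^+ k)%g.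
  elim: k => [|k IHk]; first by rewrite mul0n /P big_geq.
  rewrite mulSn addnC /P (big_cat_nat (n := k * p)) ?leq_addr //= -/(P _ x) IHk.
  rewrite expgSr; congr (_ * _)%g.
  rewrite -{1}[k * p]add0n big_addn addKn.
  by apply: eq_bigr => i _; rewrite iterD perT.
exists (#|[set: {perm X}]| * p); rewrite /dehornoy_prop muln_gt0 cardG_gt0 order_gt0 /=.
apply/forallP => x; apply/forallP => y; rewrite PE PM.
by rewrite expg_cardG ?inE // perm1.
Qed.

Definition dehornoy_class : nat := ex_minn dehornoy_exists.

End Dehornoy.

Definition max_perm_order (n : nat) : nat := \max_(s : 'S_n) #[s]%g.

(* Main.v *)
Require Import Defs.
From mathcomp Require Import all_boot all_fingroup all_solvable.

(** The Dehornoy class of any finite solution is at most the order of its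
    permutation group G; when G is cyclic, that order is the order of a single
    permutation of X.

    Fix x and let h_k be the permutation y |-> Omega_(k+1)(x, ..., x, y), so
    that h_0 = 1, and the class is the least d > 0 with h_d = 1 for all x. The
    recursion for Omega says that h_(k+1) is obtained from h_k by the map
    [translation x] on Sym(X), which does not depend on k
    ([Omega_translation]). Translations are injective because the square map
    x |-> x . x is ([translation_inj]), they commute because of the cycle set
    identity ([translationC]), and they preserve G. So they generate an abelian
    permutation group, in which the stabiliser of 1 is normal with index the
    length of the orbit of 1: raising any translation to that length fixes 1
    ([abelian_expg_orbit_fix]). The orbit is contained in G, hence the bound
    ([dehornoy_class_le_card]). *)

Local Open Scope group_scope.

Section CycleSet.

Variables (X : finType) (r : solution X).

Lemma sigma_braid x y :
  sigma r y * sigma r x =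
  sigma r (rmap r y x) * sigma r (sigma r x y).
Proof.
apply/permP => z; rewrite !permM.
have /(congr1 (fun t => t.1.1)) /= := sol_braided r (x, y, z).
by rewrite !sigmaE /rmap => <-.
Qed.

(** Since r is an involution, the second component of r(x, x . y) = (y, _)
    has to be y . x. *)
Lemma rmap_dot x y : rmap r (dot r x y) x = dot r y x.
Proof.
have rl : (r (x, dot r x y)).1 = y by rewrite -sigmaE /dot permKV.
have := sol_involutive r (x, dot r x y).
rewrite (surjective_pairing (r (x, _))) rl -/(rmap r (dot r x y) x).
move/(congr1 fst) => /=; rewrite -sigmaE => rr.
by apply: (@perm_inj _ (sigma r y)); rewrite rr permKV.
Qed.

(** The cycle set identity (x . y) . (x . z) = (y . x) . (y . z), as an equality
    of the inverses of the two maps of z. *)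
Lemma sigma_dotC x y :
  sigma r (dot r x y) * sigma r x = sigma r (dot r y x) * sigma r y.
Proof. by rewrite sigma_braid rmap_dot {2}/dot permKV. Qed.

End CycleSet.

Section Translation.

Variables (X : finType) (r : solution X).

(** In terms of the inverse g of h, this is g |-> g o sigma_(g^-1 x), which on
    the permutation group is the addition of sigma_x in its brace structure. *)
Definition translation_fun (x : X) (h : {perm X}) : {perm X} :=
  h * (sigma r (h x))^-1.

(** The translate of h sends x to the square of h x, so it determines h x. *)
Lemma translation_inj x : injective (translation_fun x).
Proof.
have diagE h : translation_fun x h x = diag r (h x) by rewrite permM.
move=> g h eq_gh; have /diag_inj eq_x: diag r (g x) = diag r (h x).
  by rewrite -!diagE eq_gh.
by move: eq_gh; rewrite /translation_fun eq_x => /mulIg.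
Qed.

Definition translation (x : X) : {perm {perm X}} := perm (@translation_inj x).

Lemma translationE x h : translation x h = h * (sigma r (h x))^-1.
Proof. by rewrite permE. Qed.

Lemma translationC x y : commute (translation x) (translation y).
Proof.
apply/permP => h; rewrite !permM !translationE !permM -!mulgA -!invMg.
by congr (_ * _^-1); apply: sigma_dotC.
Qed.

Lemma translation_closed x h :
  h \in permutation_group r -> translation x h \in permutation_group r.
Proof.
move=> Gh; rewrite translationE groupM // groupV mem_gen //.
exact: imset_f.
Qed.

(** Iterating a translation from 1 computes the words Omega; its value at x is
    the iterated square of x, because Omega is then constant in x. *)
Lemma Omega_translation k x y :
  Omega r (@const_then X k x y) = (translation x ^+ k) 1 y.
Proof.
elim: k y => [|k IHk] y; first by rewrite /= !perm1.
rewrite Omega_const_then expgSr permM translationE permM -!IHk.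
have -> // : iter k (diag r) x = Omega r (@const_then X k x x).
by rewrite -Omega_const; apply: eq_Omega => i; rewrite /const_then if_same.
Qed.

Definition translation_group : {group {perm {perm X}}} :=
  <<[set translation x | x : X]>>%G.

Lemma translation_group_abelian : abelian translation_group.
Proof.
rewrite abelian_gen abelianE; apply/centsP => _ /imsetP[x _ ->] _ /imsetP[y _ ->].
exact: translationC.
Qed.

Lemma translation_orbit1_sub :
  orbit 'P translation_group 1 \subset permutation_group r.
Proof.
have actsG : [acts translation_group, on permutation_group r | 'P].
  rewrite gen_subG; apply/subsetP => _ /imsetP[x _ ->].
  rewrite !inE; apply/subsetP => h Gh; rewrite inE /=.
  exact: translation_closed.
by rewrite acts_sub_orbit.
Qed.

End Translation.

(** Normality of the point stabilisers is what makes the orbit length, which is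
    their index, an exponent that sends the group into them. *)
Lemma abelian_expg_orbit_fix (T : finType) (A : {group {perm T}}) a (t : T) :
  abelian A -> a \in A -> (a ^+ #|orbit 'P A t|) t = t.
Proof.
move=> abA Aa; have nsA : 'C_A[t | 'P] <| A.
  by rewrite -sub_abelian_normal ?subsetIl.
have Na := subsetP (normal_norm nsA) a Aa.
have : a ^+ #|orbit 'P A t| \in 'C_A[t | 'P].
  rewrite card_orbit -card_quotient ?normal_norm // coset_idr ?groupX //.
  by rewrite morphX // expg_cardG ?mem_quotient.
by case/setIP => _ /astab1P.
Qed.

Lemma dehornoy_class_le_card (X : finType) (r : solution X) :
  dehornoy_class r <= #|permutation_group r|.
Proof.
apply: leq_trans (subset_leq_card (translation_orbit1_sub X r)).
rewrite /dehornoy_class; case: ex_minnP => d _; apply; apply/andP; split.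
  by apply/card_gt0P; exists 1; apply: orbit_refl.
apply/forallP => x; apply/forallP => y; rewrite Omega_translation.
rewrite abelian_expg_orbit_fix ?perm1 ?translation_group_abelian //.
by rewrite mem_gen // imset_f.
Qed.

Lemma order_perm_le_max (X : finType) (s : {perm X}) :
  #[s] <= max_perm_order #|X|.
Proof.
have inj : injective (fun i : 'I_#|X| => enum_rank (s (enum_val i))).
  by move=> i j /enum_rank_inj /perm_inj /enum_val_inj.
pose s' := perm inj.
have s'X k i : (s' ^+ k) i = enum_rank ((s ^+ k) (enum_val i)).
  elim: k => [|k IHk]; first by rewrite !perm1 enum_valK.
  by rewrite !expgSr !permM IHk permE enum_rankK.
suff /dvdn_leq le_ss' : #[s] %| #[s'].
  exact: leq_trans (le_ss' (order_gt0 _)) (leq_bigmax s').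
rewrite order_dvdn; apply/eqP/permP => x; apply: enum_rank_inj.
by rewrite -{1}[x]enum_rankK -s'X expg_order !perm1.
Qed.

Local Close Scope group_scope.

Theorem proposition5p7 (X : finType) (r : solution X) (n : nat) :
  #|X| = n -> cyclic (permutation_group r) ->
  dehornoy_class r <= max_perm_order n.
Proof.
move=> <- /cyclicP[s genG]; apply: leq_trans (dehornoy_class_le_card X r) _.
by rewrite genG; apply: order_perm_le_max.
Qed.
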